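(* Let $(\mathcal{X},F)$ and $(\mathcal{Y},G)$ be connected and compact Finsler manifolds. Then every almost isometry $\tau:\mathcal{X}\to\mathcal{Y}$ (with respect to the Finsler distances) is strict.
   Context: A quasi-metric on a nonempty set $X$ is a function $d:X\times X\to[0,\infty)$ with $d(x,x)=0$; $d(x,y)=d(y,x)=0$ implies $x=y$; and $d(x,y)\le d(x,z)+d(z,y)$. A bijection $\tau:(X,d_X)\to(Y,d_Y)$ of quasi-metric spaces is an almost isometry if $\mathrm{Tr}_Y(\tau(x_1),\tau(x_2),\tau(x_3))=\mathrm{Tr}_X(x_1,x_2,x_3)$ for all $x_1,x_2,x_3\in X$, where $\mathrm{Tr}_X(x_1,x_2,x_3)=d_X(x_1,x_2)+d_X(x_2,x_3)-d_X(x_1,x_3)$ (similarly for $Y$). It is strict if moreover there is $c\ge1$ with $c^{-1}d_X(x_1,x_2)\le d_Y(\tau(x_1),\tau(x_2))\le c\,d_X(x_1,x_2)$ for all $x_1,x_2\in X$. A Minkowski norm on a finite-dimensional real vector space $V$ is a function $F:V\to[0,\infty)$ with $F(\lambda v)=\lambda F(v)$ for $\lambda\ge 0$, continuous on $V$ and $C^\infty$ on $V\setminus\{0\}$, such that for every $v\ne0$ the quadratic form $\frac12 d^2[F^2](v)$ is positive definite. A Finsler manifold is a finite-dimensional $C^\infty$ manifold $\mathcal{X}$ with a continuous $F:T\mathcal{X}\to[0,\infty)$ that is $C^\infty$ off the zero section and such that each $F(x,\cdot)$ is a Minkowski norm on $T_x\mathcal{X}$ (not assumed symmetric). For connected $\mathcal{X}$,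 the Finsler distance $d_{\mathcal{X}}(x,y)$ is the infimum of $\int_a^b F(\sigma(t),\dot\sigma(t))\,dt$ over piecewise $C^1$ paths $\sigma:[a,b]\to\mathcal{X}$ from $x$ to $y$; it is a quasi-metric. *)

(* Defs.v *)
From HB Require Import structures.
From mathcomp Require Import all_boot all_order all_algebra.
From mathcomp Require Import all_classical all_reals all_analysis.

Set Implicit Arguments.
Unset Strict Implicit.
Unset Printing Implicit Defensive.

Import Order.TTheory GRing.Theory Num.Theory.
Import numFieldNormedType.Exports.

Local Open Scope classical_set_scope.
Local Open Scope ring_scope.

(* For finite-dimensional V and open D, this is the usual notion of a C^k map
   on D: x |-> 'd f x is C^k iff x |-> 'D_v f x is C^k for every v. *)
Fixpoint Ck_on (R : realType) (V W : normedModType R) (k : nat)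
    (D : set V) (f : V -> W) {struct k} : Prop :=
  match k with
  | 0%N => forall x, D x -> {for x, continuous f}
  | k'.+1 => (forall x, D x -> differentiable f x) /\
             forall v, Ck_on k' D (fun x => 'D_v f x)
  end.

Definition smooth_on (R : realType) (V W : normedModType R) (D : set V)
    (f : V -> W) : Prop :=
  forall k, Ck_on k D f.

(* [chart_fun] and [chart_inv] are total, with irrelevant values outside
   [chart_dom] and [chart_cod]. *)
Record chart (R : realType) (n : nat) (X : topologicalType) := Chart {
  chart_dom : set X ;
  chart_fun :> X -> 'rV[R]_n ;
  chart_inv : 'rV[R]_n -> X ;
  chart_cod := chart_fun @` chart_dom ;
  _ : open chart_dom ;
  _ : open chart_cod ;
  _ : {in chart_dom, cancel chart_fun chart_inv} ;
  _ : {within chart_dom, continuous chart_fun} ;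
  _ : {within chart_cod, continuous chart_inv}
}.

(* [chart_at] selects a chart around every point; it is used below to
   coordinatize the tangent spaces.  The atlas need not be maximal. *)
Record smoothManifold (R : realType) := SmoothManifold {
  mcarrier :> topologicalType ;
  mdim : nat ;
  atlas : set (chart R mdim mcarrier) ;
  chart_at : mcarrier -> chart R mdim mcarrier ;
  _ : [set: mcarrier] !=set0 ;
  _ : hausdorff_space mcarrier ;
  _ : @second_countable mcarrier ;
  _ : forall x, atlas (chart_at x) ;
  _ : forall x, chart_dom (chart_at x) x ;
  _ : forall phi psi, atlas phi -> atlas psi ->
      smooth_on (phi @` (chart_dom phi `&` chart_dom psi))
                (psi \o chart_inv phi)
}.

Record minkowski_norm (R : realType) (n : nat) (F : 'rV[R]_n -> R) : Prop := {
  minkowski_ge0 : forall v, 0 <= F v ;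
  minkowski_homogeneous : forall (l : R) v, 0 <= l -> F (l *: v) = l * F v ;
  minkowski_continuous : continuous F ;
  minkowski_smooth : smooth_on [set v | v != 0] F ;
  minkowski_convex : forall v w, v != 0 -> w != 0 ->
    0 < 2^-1 * 'D_w (fun u => 'D_w (fun y => F y ^+ 2) u) v
}.

(* A tangent vector at x is given by its coordinates in the chart
   [chart_at x], so that T_x X is identified with 'rV[R]_(mdim X) and a
   function on TX is a map F : X -> 'rV_(mdim X) -> R.  [in_chart F phi] is the
   expression of F in the chart of TX induced by phi: the vector with
   coordinates p.2 in phi has coordinates
   'd (chart_at x \o chart_inv phi) p.1 p.2 in [chart_at x]. *)
Definition in_chart (R : realType) (X : smoothManifold R)
    (F : X -> 'rV[R]_(mdim X) -> R) (phi : chart R (mdim X) X)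
    (p : 'rV[R]_(mdim X) * 'rV[R]_(mdim X)) : R :=
  let x := chart_inv phi p.1 in
  F x ('d (chart_at x \o chart_inv phi) (p.1) (p.2)).

Record finslerManifold (R : realType) := FinslerManifold {
  fbase :> smoothManifold R ;
  fnorm : fbase -> 'rV[R]_(mdim fbase) -> R ;
  _ : forall x, minkowski_norm (fnorm x) ;
  _ : forall phi, atlas phi ->
      Ck_on 0 [set p | chart_cod phi p.1] (in_chart fnorm phi) ;
  _ : forall phi, atlas phi ->
      smooth_on [set p | chart_cod phi p.1 /\ p.2 != 0] (in_chart fnorm phi)
}.

(* C^1 on a closed segment: in every chart, the path extends locally to a C^1
   map on an open subset of R. *)
Definition C1_on_segment (R : realType) (X : smoothManifold R)
    (a b : R) (sigma : R -> X) : Prop :=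
  forall (phi : chart R (mdim X) X) (t0 : R),
    atlas phi -> t0 \in `[a, b] -> chart_dom phi (sigma t0) ->
    exists (U : set R) (g : R -> 'rV[R]_(mdim X)),
      [/\ open U, U t0, Ck_on 1 U g &
          forall t, U t -> t \in `[a, b] -> g t = phi (sigma t)].

(* a <= b follows from itv_partition; for a = b the partition is empty. *)
Definition piecewise_C1 (R : realType) (X : smoothManifold R)
    (a b : R) (sigma : R -> X) : Prop :=
  {within `[a, b], continuous sigma} /\
  exists s : seq R, itv_partition a b s /\
    forall i, (i < size s)%N ->
      C1_on_segment (nth b (a :: s) i) (nth b (a :: s) i.+1) sigma.

(* The velocity at t, as an element of the tangent space at sigma t. *)
Definition velocity (R : realType) (X : smoothManifold R) (sigma : R -> X)
    (t : R) : 'rV[R]_(mdim X) :=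
  derive1 (chart_at (sigma t) \o sigma) t.

(* The integrand is irrelevant at the finitely many break points, where the
   velocity may not exist. *)
Definition path_length (R : realType) (X : finslerManifold R)
    (a b : R) (sigma : R -> X) : R :=
  Rintegral (@lebesgue_measure R) `[a, b]
    (fun t => fnorm (sigma t) (velocity sigma t)).

Definition finsler_dist (R : realType) (X : finslerManifold R) (x y : X) : R :=
  inf [set L | exists (a b : R) (sigma : R -> X),
    [/\ piecewise_C1 a b sigma, sigma a = x, sigma b = y &
        L = path_length a b sigma]].

Definition Tr (R : realType) (T : Type) (d : T -> T -> R) (x1 x2 x3 : T) : R :=
  d x1 x2 + d x2 x3 - d x1 x3.

Definition almost_isometry (R : realType) (T U : Type)
    (dT : T -> T -> R) (dU : U -> U -> R) (tau : T -> U) : Prop :=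
  bijective tau /\
  forall x1 x2 x3, Tr dU (tau x1) (tau x2) (tau x3) = Tr dT x1 x2 x3.

Definition strict_almost_isometry (R : realType) (T U : Type)
    (dT : T -> T -> R) (dU : U -> U -> R) (tau : T -> U) : Prop :=
  almost_isometry dT dU tau /\
  exists2 c : R, 1 <= c &
    forall x1 x2, c^-1 * dT x1 x2 <= dU (tau x1) (tau x2) <= c * dT x1 x2.

(* Main.v *)
Require Import Defs.
From HB Require Import structures.
From mathcomp Require Import all_boot all_order all_algebra.
From mathcomp Require Import all_classical all_reals all_analysis.
From mathcomp Require Import lra.

Import Order.TTheory GRing.Theory Num.Theory.
Import numFieldNormedType.Exports.

Local Open Scope classical_set_scope.
Local Open Scope ring_scope.

(** Taking x3 = x1 in the invariance of the triangular function shows that an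
almost isometry preserves the symmetrized distance d(x, y) + d(y, x).  So it is
enough to compare d with its symmetrization on each side, that is, to find a
constant C such that d(y, x) <= C d(x, y) for all x and y
([finsler_dist_rev_le]): then
dY(tau x1, tau x2) <= dX(x1, x2) + dX(x2, x1) <= (1 + C) dX(x1, x2), and
likewise with the two manifolds exchanged.

Such a constant exists as soon as F(x, -v) <= C F(x, v) for all tangent vectors
v, since traversing a path backwards then multiplies its length by at most C.
On a compact manifold this bound follows from two compactness arguments
([fnorm_reversible]).  In a chart, F is continuous and is positive on nonzero
vectors ([minkowski_gt0]), so compactness of the unit sphere bounds the ratio
F(-w) / F(w) uniformly near each point; compactness of the manifold makes the
bound global.

For lengths, the integrand of a path is only known to be nonnegative: its
measurability would have to be extracted from the arbitrary choice of a chart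
at each point.  The comparison of the two integrals is therefore made on the
simple functions that lie below the integrands ([le_integral_reflection]),
where measurability costs nothing.  It holds in both directions, so one length
is infinite exactly when the other is. *)

Set Implicit Arguments.
Unset Strict Implicit.
Unset Printing Implicit Defensive.

(** * Positivity of Minkowski norms *)

(** If F v = 0, homogeneity makes F vanish on the whole ray through v, so that
the second derivative of F ^ 2 at v in the direction v is zero, against strong
convexity. *)
Lemma minkowski_gt0 (R : realType) (n : nat) (F : 'rV[R]_n -> R) :
  minkowski_norm F -> forall v, v != 0 -> 0 < F v.
Proof.
move=> mF v v0; rewrite lt_neqAle minkowski_ge0// andbT eq_sym.
apply/eqP => Fv0.
have F0 l : 0 <= l -> F (l *: v) = 0.
  by move=> l0; rewrite (minkowski_homogeneous mF)// Fv0 mulr0.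
(* F vanishes on the open ray through v, which contains (h + 1) v *)
have ray (h : R) : -1 < h -> 'D_v (fun y => F y ^+ 2) (h *: v + v) = 0.
  move=> h1; apply: lim_near_cst => //=; near=> k.
  have -> : k *: v + (h *: v + v) = (k + h + 1) *: v.
    by rewrite !scalerDl scale1r addrA.
  have -> : h *: v + v = (h + 1) *: v by rewrite scalerDl scale1r.
  have : `|k| < h + 1 by near: k; apply: dnbhs0_lt; lra.
  rewrite ltr_norml => /andP[k1 k2].
  by rewrite !F0 ?subrr ?scaler0//; lra.
have := minkowski_convex mF v0 v0.
suff -> : 'D_v (fun u => 'D_v (fun y => F y ^+ 2) u) v = 0.
  by rewrite mulr0 ltxx.
apply: lim_near_cst => //=; near=> h.
have h1 : `|h| < 1 by near: h; apply: dnbhs0_lt.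
rewrite ray; last by move: h1; rewrite ltr_norml => /andP[].
have := ray 0 (ltrN10 R); rewrite scale0r add0r => ->.
by rewrite subrr scaler0.
Unshelve. all: by end_near. Qed.

(** * Charts and tangent coordinates *)

Section chart_facts.
Variables (R : realType) (n : nat) (X : topologicalType) (phi : chart R n X).

Lemma chart_dom_open : open (chart_dom phi).
Proof. by case: phi. Qed.

Lemma chart_invK x : chart_dom phi x -> chart_inv phi (phi x) = x.
Proof. by case: phi => /= D f g _ _ fK _ _ Dx; apply: fK; rewrite inE. Qed.

Lemma chart_fun_continuous x : chart_dom phi x -> {for x, continuous phi}.
Proof.
case: phi => /= D f g oD _ _ cf _ Dx.
by move: cf; rewrite continuous_open_subspace// => /(_ x); apply; rewrite inE.
Qed.

Lemma chart_inv_continuous p : chart_cod phi p ->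
  {for p, continuous (chart_inv phi)}.
Proof.
rewrite /chart_cod; case: phi => /= D f g _ oC _ _ cg Cp.
by move: cg; rewrite continuous_open_subspace// => /(_ p); apply; rewrite inE.
Qed.

Lemma near_chart_cod p : chart_cod phi p -> \near p, chart_cod phi p.
Proof.
move=> Cp; apply: open_nbhs_nbhs; split => //.
by rewrite /chart_cod; case: (phi).
Qed.

Lemma chart_funK p : chart_cod phi p -> phi (chart_inv phi p) = p.
Proof. by move=> [x Dx <-]; rewrite chart_invK. Qed.

End chart_facts.

Lemma transition_differentiable (R : realType) (X : smoothManifold R)
    (phi psi : chart R (mdim X) X) x :
  atlas phi -> atlas psi -> chart_dom phi x -> chart_dom psi x ->
  differentiable (psi \o chart_inv phi) (phi x).
Proof.
move=> aphi apsi phix psix; have smooth : smooth_on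
    (phi @` (chart_dom phi `&` chart_dom psi)) (psi \o chart_inv phi).
  by case: (X) phi psi aphi apsi {phix psix} => /= ? ? ? ? _ _ _ _ _; apply.
by have [+ _] := smooth 1%N; apply; exists x.
Qed.

(** By the chain rule: near psi x, the composite of the two coordinate changes
is the identity. *)
Lemma diff_transitionK (R : realType) (X : smoothManifold R)
    (phi psi : chart R (mdim X) X) (x : X) (v : 'rV[R]_(mdim X)) :
  atlas phi -> atlas psi -> chart_dom phi x -> chart_dom psi x ->
  'd (psi \o chart_inv phi) (phi x) ('d (phi \o chart_inv psi) (psi x) v) = v.
Proof.
move=> aphi apsi phix psix.
have dphi := transition_differentiable aphi apsi phix psix.
have dpsi := transition_differentiable apsi aphi psix phix.
have phiE : (phi \o chart_inv psi) (psi x) = phi x by rewrite /= chart_invK.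
rewrite -phiE in dphi.
have := diff_comp dpsi dphi; rewrite phiE => /(congr1 (fun f => f v)) /= <-.
have dcomp := differentiable_comp dpsi dphi.
rewrite -deriveE//.
transitivity ('D_v (@id 'rV[R]_(mdim X)) (psi x)); last by rewrite derive_id.
apply: near_eq_derive.
have codx : chart_cod psi (psi x) by exists x.
have /(chart_inv_continuous codx) :
    nbhs (chart_inv psi (psi x)) (chart_dom phi).
  rewrite chart_invK//; apply: open_nbhs_nbhs; split => //.
  exact: chart_dom_open.
move=> near_phi; near=> p; rewrite /= chart_invK; last by near: p.
by apply: chart_funK; near: p; exact: near_chart_cod.
Unshelve. all: by end_near. Qed.

(** * Reversibility of the Finsler norm *)

Section reversibility.
Variables (R : realType) (X : finslerManifold R).
Local Notation F := (@fnorm R X).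

Lemma fnorm_minkowski x : minkowski_norm (F x).
Proof. by case: X x. Qed.

Lemma fnorm0 x : F x 0 = 0.
Proof.
have := minkowski_homogeneous (fnorm_minkowski x) 0 (lexx 0).
by rewrite scale0r mul0r.
Qed.

Lemma in_chart_continuous phi p : atlas phi -> chart_cod phi p.1 ->
  {for p, continuous (in_chart F phi)}.
Proof. by case: X phi p => /= B G _ + _ phi p aphi => /(_ phi aphi); apply. Qed.

Lemma atlas_chart_at (x : X) : atlas (chart_at x).
Proof. by case: X x => /= B G _ _ _; case: (B) => /=. Qed.

Lemma chart_at_dom (x : X) : chart_dom (chart_at x) x.
Proof. by case: X x => /= B G _ _ _; case: (B) => /=. Qed.

Lemma fnorm_in_chart (phi : chart R (mdim X) X) (x : X) w :
  chart_dom phi x -> in_chart F phi (phi x, w) =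
    F x ('d (chart_at x \o chart_inv phi) (phi x) w).
Proof. by move=> phix; rewrite /in_chart /= chart_invK. Qed.

(** The inequality is proved on the unit sphere of the coordinates induced by
the fixed chart at x0, where continuity in both variables is available, and
then extended by homogeneity.  Letting C tend to infinity along a filter makes
both passages from local to global, over the sphere and over the manifold,
instances of the near-covering form of compactness. *)
Lemma fnorm_reversible_near (x0 : X) :
  \forall x \near x0 & C \near +oo, forall v, F x (- v) <= C * F x v.
Proof.
set phi := chart_at x0.
have aphi : atlas phi := atlas_chart_at x0.
have phix0 : chart_dom phi x0 := chart_at_dom x0.
pose S := [set w : 'rV[R]_(mdim X) | `|w| = 1].
have S_compact : compact S.
  apply: bounded_closed_compact.
    by exists 1; split => // M M1 w /= ->; exact: ltW.
  apply: (@closed_comp _ _ (fun w : 'rV[R]_(mdim X) => `|w|) [set 1]).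
    by move=> w _; exact: norm_continuous.
  exact: closed_eq.
have sphere_bound : \forall i \near (filter_prod (nbhs (phi x0)) +oo),
    S `<=` (fun w =>
      in_chart F phi (i.1, - w) <= i.2 * in_chart F phi (i.1, w)).
  move/compact_near_coveringP : S_compact; apply => w0 Sw0.
  have codx0 : chart_cod phi (phi x0) by exists x0.
  (* the coordinate change is injective, so w0 represents a nonzero vector *)
  have Gw0 : 0 < in_chart F phi (phi x0, w0).
    rewrite fnorm_in_chart//; apply: minkowski_gt0 (fnorm_minkowski x0) _ _.
    apply/eqP => d0.
    have := diff_transitionK w0 aphi aphi phix0 phix0.
    rewrite d0 linear0 => w00; move: Sw0; rewrite /S/= -w00 normr0.
    by move/eqP; rewrite eq_sym oner_eq0.
  (* for vectors near w0 and base points near x0 the ratio is at most M / m *)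
  set m := in_chart F phi (phi x0, w0) / 2.
  set M := in_chart F phi (phi x0, - w0) + 1.
  have m0 : 0 < m by rewrite divr_gt0.
  have lower : \forall q \near (phi x0, w0), m < in_chart F phi q.
    apply: (cvgr_gt _ (in_chart_continuous (p := (phi x0, w0)) aphi codx0)).
    by rewrite ltr_pdivrMr// mulr2n mulrDr mulr1 ltrDl.
  have upper : \forall q \near (phi x0, - w0), in_chart F phi q < M.
    apply: (cvgr_lt _ (in_chart_continuous (p := (phi x0, - w0)) aphi codx0)).
    by rewrite ltrDl.
  case: lower => -[U V] /= [Ux0 Vw0] lower.
  case: upper => -[U' V'] /= [U'x0 V'w0] upper.
  exists (V `&` [set w | V' (- w)], (U `&` U') `*` [set C | M / m <= C]) => /=.
    split; first by apply: filterI => //; exact: oppr_continuous V'w0.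
    exists (U `&` U', [set C | M / m <= C]) => //=; split; first exact: filterI.
    by apply: nbhs_pinfty_ge; exact: num_real.
  move=> [w [p C]] /= [[Vw V'w] [[Up U'p] MC]].
  apply: le_trans (ltW (upper (p, - w) _)) _ => //=.
  apply: le_trans (_ : M / m * m <= _); first by rewrite divfK// gt_eqF.
  have mG := lower (p, w) (conj Up Vw).
  apply: ler_pM MC (ltW mG); last exact: ltW.
  rewrite divr_ge0 ?(ltW m0)// addr_ge0// fnorm_in_chart//.
  exact: (minkowski_ge0 (fnorm_minkowski x0)).
case: sphere_bound => -[U K] /= [Ux0 Ky] bound.
exists (phi @^-1` U `&` chart_dom phi, K) => /=.
  split => //; apply: filterI; first exact: chart_fun_continuous Ux0.
  by apply: open_nbhs_nbhs; split => //; exact: chart_dom_open.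
move=> [x C] /= [[Ux phix] KC] v.
(* w represents v in the fixed chart *)
set w := 'd (phi \o chart_inv (chart_at x)) (chart_at x x) v.
have FE u : in_chart F phi (phi x, u) =
    F x ('d (chart_at x \o chart_inv phi) (phi x) u) by exact: fnorm_in_chart.
have vE : 'd (chart_at x \o chart_inv phi) (phi x) w = v.
  exact: diff_transitionK aphi (atlas_chart_at x) phix (chart_at_dom x).
have [w0|w0] := eqVneq w 0.
  by rewrite -vE w0 linear0 oppr0 fnorm0 mulr0.
have nw : 0 < `|w| by rewrite normr_gt0.
have Sw : S (`|w|^-1 *: w).
  by rewrite /S/= normrZ normfV normr_id mulVf// gt_eqF.
have /= := bound (phi x, C) (conj Ux KC) _ Sw.
have i0 : 0 <= `|w|^-1 by rewrite invr_ge0.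
rewrite -scalerN !FE !linearZ/= linearN/= vE.
rewrite !(minkowski_homogeneous (fnorm_minkowski x))// mulrCA.
by rewrite ler_pM2l// invr_gt0.
Qed.

End reversibility.

Lemma fnorm_reversible (R : realType) (X : finslerManifold R) :
  compact [set: X] ->
  exists2 C : R, 1 <= C & forall (x : X) v, fnorm x (- v) <= C * fnorm x v.
Proof.
move=> /compact_near_coveringP cX.
have : \forall C \near +oo, [set: X] `<=`
    (fun x : X => forall v, fnorm x (- v) <= C * fnorm x v).
  by apply: cX => x _; exact: fnorm_reversible_near.
move=> H; near (pinfty_nbhs R) => C.
have C1 : 1 <= C by near: C; exact: nbhs_pinfty_ge.
exists C => // x v.
by move: x I v; near: C.
Unshelve. all: by end_near. Qed.

(** * Reflected integrals *)

Section reflection.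
Variables (R : realType) (h : {nnsfun (measurableTypeR R) >-> R}).
Import HBNNSimple.
Local Notation mu := (@lebesgue_measure R).

Definition reflection : measurableTypeR R -> R := fun x => h (- x).

Let reflection_ge0 x : 0 <= reflection x.
Proof. exact: fun_ge0. Qed.

Let reflection_measurable : measurable_fun setT reflection.
Proof.
apply: (@measurableT_comp _ _ _ _ _ _ h); first by [].
exact: measurable_realfun.oppr_measurable.
Qed.

Let reflection_finite : finite_set (range reflection).
Proof.
apply: sub_finite_set (@fimfunP _ _ h) => _ [x _ <-].
by exists (- x).
Qed.

HB.instance Definition _ :=
  @isNonNegFun.Build _ _ reflection reflection_ge0.
HB.instance Definition _ :=
  @isMeasurableFun.Build _ _ _ _ reflection reflection_measurable.
HB.instance Definition _ :=
  @FiniteImage.Build _ _ reflection reflection_finite.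

Definition reflection_nnsfun : {nnsfun (measurableTypeR R) >-> R} := reflection.

Lemma sintegral_reflection : sintegral mu reflection_nnsfun = sintegral mu h.
Proof.
rewrite /sintegral; apply: eq_fsbigr => r _; congr (_ * _)%E.
rewrite -[RHS]lebesgue_measureN//.
by apply: (measurable_funPTI h); exact: measurable_set1.
Qed.

End reflection.

(** A simple function h below f gives the simple function h(- x) / C below g,
with integral divided by C, and both integrals are suprema over such functions;
this includes non-measurable f and g. *)
Lemma le_integral_reflection (R : realType) (C : R) (f g : R -> \bar R) :
  0 < C -> (forall x, 0 <= f x)%E -> (forall x, 0 <= g x)%E ->
  (forall x, f x <= C%:E * g (- x)%R)%E ->
  (\int[@lebesgue_measure R]_x f x <=
    C%:E * \int[@lebesgue_measure R]_x g x)%E.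
Proof.
move=> C0 f0 g0 fg; rewrite !ge0_integralTE//.
apply: ge_ereal_sup => _ [h /= hf <-].
have Ci0 : 0 <= C^-1 by rewrite invr_ge0 ltW.
rewrite -lee_pdivrMl// -sintegral_reflection -sintegralrM.
apply: ereal_sup_ubound.
exists (scale_nnsfun (reflection_nnsfun h) Ci0) => //= x.
rewrite EFinM lee_pdivrMl//.
by apply: le_trans (hf _) _; rewrite -{2}(opprK x).
Qed.

(** * Reversed paths *)

(** The second alternative is for maps without a derivative at - t, for which
derive1 takes a default value that the sign does not change.  Both alternatives
lead to the same bound on speeds, so that break points of paths are treated
like the others. *)
Lemma derive1_comp_opp (R : realType) (V : normedModType R) (f : R -> V) t :
  derive1 (f \o -%R) t = - derive1 f (- t) \/
  derive1 (f \o -%R) t = derive1 f (- t).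
Proof.
rewrite /derive1.
set q := fun h => h^-1 *: (f (h - t) - f (- t)).
have -> : (fun h => h^-1 *: ((f \o -%R) (h + t) - (f \o -%R) t)) =
    (fun h => - q (- h)).
  by apply/funext => h; rewrite /q/= invrN scaleNr opprK opprD.
have oppq (g : R -> V) l : g @ 0^' --> l -> (fun h => - g (- h)) @ 0^' --> - l.
  move=> gl; apply: cvgN.
  apply: (@cvg_comp _ _ _ -%R g _ (0^')); last exact: gl.
  have := @dnbhsN R 0; rewrite oppr0 => {1}-> A A0.
  exists A => //; apply/seteqP.
  split=> [_ [y Ay <-]|y] /=; rewrite ?opprK // => Ay.
  by exists (- y); rewrite ?opprK.
have [/cvg_ex[l ql]|dq] := pselect (cvg (q @ 0^')).
  by left; rewrite (cvg_lim _ ql)//; apply: cvg_lim => //; exact: oppq.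
(* outside its domain of convergence, lim has the same default value *)
right; rewrite (dvgP dq); apply: dvgP => /cvg_ex[l /oppq ql].
apply: dq; apply/cvg_ex; exists (- l).
by move: ql; under eq_fun do rewrite !opprK.
Qed.

Lemma C1_on_segment_opp (R : realType) (X : smoothManifold R) a b
    (sigma : R -> X) :
  C1_on_segment a b sigma -> C1_on_segment (- b) (- a) (sigma \o -%R).
Proof.
move=> C1 phi t0 aphi t0ab phit0.
have oppab (t : R) : t \in `[- b, - a] -> - t \in `[a, b].
  by rewrite !in_itv/= => /andP[bt ta]; rewrite lerNr ta lerNl.
have [U [g [oU Ut0 [dg cg] gE]]] := C1 phi (- t0) aphi (oppab _ t0ab) phit0.
exists (-%R @^-1` U), (g \o -%R); split => //=.
- by move/continuousP : (@oppr_continuous R R); apply.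
- split=> [t Ut|v t Ut].
    by apply: differentiable_comp => //; exact: dg.
  have -> : (fun y => 'D_v (g \o -%R) y) = (fun y => 'D_(- v) g y) \o -%R.
    apply/funext => y; rewrite /derive /=.
    set d := (X in lim (X @ _)); set d' := (X in _ = lim (X @ _)).
    suff -> : d = d' by [].
    by apply: funext => h; rewrite /d /d' opprD scalerN.
  apply: continuous_comp; first exact: oppr_continuous.
  exact: (cg (- v) (- t) Ut).
- by move=> t Ut tab; rewrite gE// oppab.
Qed.

(** The reversed subdivision has the opposite points in reverse order; indices
stay within bounds, so the different default values are never reached. *)
Lemma nth_itv_partition_rev (R : realType) (a b : R) s (i : nat) :
  itv_partition a b s -> (i <= size s)%N ->
  nth (- a) (- b :: rev (belast (- a) (map -%R s))) i =
  - nth b (a :: s) (size s - i).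
Proof.
move=> [_ /eqP abs] ilt.
have -> : - b :: rev (belast (- a) (map -%R s)) = rev (map -%R (a :: s)).
  by rewrite /= (lastI (- a)) rev_rcons last_map abs.
rewrite nth_rev size_map//= ?ltnS// -[_ :: map _ _]/(map -%R (a :: s)) subSS.
by rewrite (nth_map b)//= ltnS leq_subr.
Qed.

Lemma piecewise_C1_opp (R : realType) (X : smoothManifold R) a b
    (sigma : R -> X) :
  piecewise_C1 a b sigma -> piecewise_C1 (- b) (- a) (sigma \o -%R).
Proof.
move=> [csigma [s [abs C1]]]; split.
  apply/subspace_continuousP => t tab.
  have tab' : `[a, b]%classic (- t).
    by move: tab; rewrite /= !in_itv/= => /andP[bt ta]; rewrite lerNr ta lerNl.
  move/subspace_continuousP : csigma => /(_ _ tab') ct.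
  apply: (cvg_comp _ _ _ ct) => A; rewrite /within/= => /oppr_continuous near_A.
  apply: (@filterS _ (nbhs t) _ _ _ _ near_A) => y /= Ay yab; apply: Ay.
  by move: yab; rewrite !in_itv/= => /andP[bt ta]; rewrite lerNr ta lerNl.
exists (rev (belast (- a) (map -%R s))); split; first exact: itv_partition_rev.
move=> i; rewrite size_rev size_belast size_map => ilt.
rewrite !(nth_itv_partition_rev abs)//; last exact: ltnW.
rewrite -[X in nth _ _ X](subnSK ilt).
apply: C1_on_segment_opp; apply: C1.
by rewrite ltn_subrL (leq_ltn_trans _ ilt).
Qed.

(** * Lengths and distances *)

Lemma path_length_ge0 (R : realType) (X : finslerManifold R) a b
    (sigma : R -> X) :
  0 <= path_length a b sigma.
Proof.
apply: fine_ge0; apply: integral_ge0 => t _; rewrite lee_fin.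
exact: (minkowski_ge0 (fnorm_minkowski _)).
Qed.

Section reversed_length.
Variables (R : realType) (X : finslerManifold R) (C : R).
Hypothesis C1 : 1 <= C.
Hypothesis revC : forall (x : X) v, fnorm x (- v) <= C * fnorm x v.

Let length_integral a b (sigma : R -> X) :=
  (\int[@lebesgue_measure R]_(t in `[a, b])
    (fnorm (sigma t) (velocity sigma t))%:E)%E.

Lemma fnorm_velocity_opp (sigma : R -> X) t :
  fnorm (sigma (- t)) (velocity (sigma \o -%R) t) <=
  C * fnorm (sigma (- t)) (velocity sigma (- t)).
Proof.
rewrite /velocity /=.
have [] := derive1_comp_opp (chart_at (sigma (- t)) \o sigma) t.
  by move=> ->; exact: revC.
move=> ->; rewrite ler_peMl//.
exact: (minkowski_ge0 (fnorm_minkowski _)).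
Qed.

Lemma length_integral_opp_le a b sigma :
  (length_integral (- b)%R (- a)%R (sigma \o -%R) <=
    C%:E * length_integral a b sigma)%E.
Proof.
have F0 c d (s : R -> X) t : (0 <= ((fun t =>
    (fnorm (s t) (velocity s t))%:E) \_ `[c, d]) t)%E.
  apply: erestrict_ge0 => {}t _; rewrite lee_fin.
  exact: (minkowski_ge0 (fnorm_minkowski _)).
rewrite /length_integral integral_mkcond [X in (_ * X)%E]integral_mkcond.
apply: le_integral_reflection => //; first exact: lt_le_trans C1.
move=> t; rewrite !patchE.
have -> : (- t \in `[a, b]%classic) = (t \in `[- b, - a]%classic).
  by rewrite !mem_setE !in_itv/= lerNr lerNl andbC.
case: ifP => _; last by rewrite mule0.
by rewrite -EFinM lee_fin; exact: fnorm_velocity_opp.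
Qed.

(** Real-valued lengths send an infinite integral to 0.  Reversing twice bounds
each integral by a multiple of the other, so that both are infinite together
and this convention does no harm. *)
Lemma path_length_opp_le a b (sigma : R -> X) :
  path_length (- b) (- a) (sigma \o -%R) <= C * path_length a b sigma.
Proof.
have I0 c d s : (0 <= length_integral c d s)%E.
  apply: integral_ge0 => t _; rewrite lee_fin.
  exact: (minkowski_ge0 (fnorm_minkowski _)).
have le1 := length_integral_opp_le a b sigma.
have := length_integral_opp_le (- b) (- a) (sigma \o -%R).
have -> : (sigma \o -%R) \o -%R = sigma by apply/funext => t /=; rewrite opprK.
rewrite !opprK => le2.
rewrite /path_length /Rintegral -/(length_integral _ _ _).
rewrite -/(length_integral a b sigma).
move: le1 le2 (I0 a b sigma) (I0 (- b) (- a) (sigma \o -%R)).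
case: (length_integral a b sigma) => [r| |];
  case: (length_integral (- b) _ _) => [r'| |] //=.
by rewrite mulr0.
Qed.

Lemma finsler_dist_rev_le (x y : X) :
  finsler_dist y x <= C * finsler_dist x y.
Proof.
have C0 : 0 < C by exact: lt_le_trans C1.
pose lengths u v : set R := [set L | exists (a b : R) (sigma : R -> X),
  [/\ piecewise_C1 a b sigma, sigma a = u, sigma b = v &
      L = path_length a b sigma]].
have rev_lengths u v L : lengths u v L ->
    exists2 L', lengths v u L' & L' <= C * L.
  move=> [a [b [s [ps sa sb ->]]]].
  exists (path_length (- b) (- a) (s \o -%R)); last exact: path_length_opp_le.
  exists (- b), (- a), (s \o -%R); split => //=; rewrite ?opprK//.
  exact: piecewise_C1_opp.
rewrite /finsler_dist -/(lengths y x) -/(lengths x y).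
have [xy0|/set0P xy_neq0] := eqVneq (lengths x y) set0.
  (* a path one way exists iff one exists the other way, and inf set0 = 0 *)
  have [->|/set0P[L /rev_lengths[L']]] := eqVneq (lengths y x) set0.
    by rewrite xy0 !inf0 mulr0.
  by rewrite xy0.
rewrite -ler_pdivrMl//; apply: lb_le_inf => // L /rev_lengths[L' yxL' L'L].
rewrite ler_pdivrMl//; apply: le_trans L'L; apply: ge_inf => //.
by exists 0 => _ [a [b [s [_ _ _ ->]]]]; exact: path_length_ge0.
Qed.

End reversed_length.

Lemma finsler_dist_ge0 (R : realType) (X : finslerManifold R) (x y : X) :
  0 <= finsler_dist x y.
Proof.
rewrite /finsler_dist; set A := (X in inf X).
have [->|/set0P A0] := eqVneq A set0; first by rewrite inf0.
by apply: lb_le_inf => // _ [a [b [s [_ _ _ ->]]]]; exact: path_length_ge0.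
Qed.

Lemma finsler_distxx (R : realType) (X : finslerManifold R) (x : X) :
  finsler_dist x x = 0.
Proof.
apply/eqP; rewrite eq_le finsler_dist_ge0 andbT; apply: ge_inf.
  by exists 0 => _ [a [b [s [_ _ _ ->]]]]; exact: path_length_ge0.
exists 0, 0, (fun=> x); split => //.
  split; first by apply: continuous_subspaceT => ?; exact: cvg_cst.
  by exists [::]; split.
by rewrite /path_length set_itv1 Rintegral_set1.
Qed.

(** * Almost isometries *)

Unset Implicit Arguments.

Theorem proposition2p26 (R : realType) (X Y : finslerManifold R)
  (connX : connected [set: X]) (compX : compact [set: X])
  (connY : connected [set: Y]) (compY : compact [set: Y])
  (tau : X -> Y) :
  almost_isometry (@finsler_dist R X) (@finsler_dist R Y) tau ->
  strict_almost_isometry (@finsler_dist R X) (@finsler_dist R Y) tau.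
Proof.
move=> tauAI; split=> //; have [_ tauTr] := tauAI.
have sym x1 x2 :
    finsler_dist (tau x1) (tau x2) + finsler_dist (tau x2) (tau x1) =
    finsler_dist x1 x2 + finsler_dist x2 x1.
  by have := tauTr x1 x2 x1; rewrite /Tr !finsler_distxx !subr0.
have [CX CX1 /(finsler_dist_rev_le CX1) revX] := fnorm_reversible compX.
have [CY CY1 /(finsler_dist_rev_le CY1) revY] := fnorm_reversible compY.
have dX0 := @finsler_dist_ge0 R X; have dY0 := @finsler_dist_ge0 R Y.
exists (1 + CX + CY) => [|x1 x2]; first lra.
rewrite ler_pdivrMl; last lra.
have := sym x1 x2; have := revX x1 x2; have := revY (tau x1) (tau x2).
have := dX0 x1 x2; have := dY0 (tau x1) (tau x2).
have := dX0 x2 x1; have := dY0 (tau x2) (tau x1).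
by move=> *; apply/andP; split; nra.
Qed.
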